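(* Let $(\mathfrak g,\{l_k\}_{k\ge1})$ be an $L_\infty$-algebra and $(V,\{\rho_k\}_{k\ge1})$ a representation of it. A degree $0$ element $T=\sum_{k\ge1}T_k\in\mathrm{Hom}(\bar{\mathsf S}(V),\mathfrak g)$, $T_k\in\mathrm{Hom}(\mathsf S^k(V),\mathfrak g)$, is a homotopy relative Rota-Baxter operator on $(\mathfrak g,\{l_k\}_{k\ge1})$ with respect to the representation $(V,\{\rho_k\}_{k\ge1})$ if and only if $T$ is a Maurer-Cartan element of the $L_\infty$-algebra $(\mathfrak h,\{\mathfrak l_k\}_{k\ge1})$ defined in the context.
   Context: The base field has characteristic $0$; vector spaces are $\mathbb Z$-graded. $\mathsf S^k(V)$ is the $k$-th graded symmetric power, $\bar{\mathsf S}(V)=\bigoplus_{i\ge1}\mathsf S^i(V)$; $\varepsilon(\sigma)$ is the Koszul sign; $\mathbb S_{(i_1,\dots,i_k)}$ are the $(i_1,\dots,i_k)$-shuffles; in exponents, an element denotes its degree. $L_\infty$-algebra: a graded vector space $\mathfrak g$ with degree $1$ graded symmetric maps $l_k:\otimes^k\mathfrak g\to\mathfrak g$ ($k\ge1$) with $\sum_{i=1}^n\sum_{\sigma\in\mathbb S_{(i,n-i)}}\varepsilon(\sigma)l_{n-i+1}(l_i(x_{\sigma(1)},\dots,x_{\sigma(i)}),x_{\sigma(i+1)},\dots,x_{\sigma(n)})=0$ for all $n\ge1$. A representation on $V$: degree $1$ maps $\rho_k:\mathsf S^{k-1}(\mathfrak g)\otimes V\to V$ ($k\ge1$) such that for all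 $n\ge1$ and homogeneous $x_i\in\mathfrak g$, $v\in V$, $$\sum_{i=1}^{n-1}\sum_{\sigma\in\mathbb S_{(i,n-i-1)}}\varepsilon(\sigma)\rho_{n-i+1}(l_i(x_{\sigma(1)},\dots,x_{\sigma(i)}),x_{\sigma(i+1)},\dots,x_{\sigma(n-1)},v)+\sum_{i=1}^n\sum_{\sigma\in\mathbb S_{(n-i,i-1)}}\varepsilon(\sigma)(-1)^{x_{\sigma(1)}+\cdots+x_{\sigma(n-i)}}\rho_{n-i+1}(x_{\sigma(1)},\dots,x_{\sigma(n-i)},\rho_i(x_{\sigma(n-i+1)},\dots,x_{\sigma(n-1)},v))=0.$$ Homotopy relative Rota-Baxter operator: a degree $0$ element $T=\sum_kT_k$ such that for all $p\ge1$ and homogeneous $v_1,\dots,v_p\in V$, $$\sum_{\substack{0\le t\le p-1,\ m\ge0\\k_1+\cdots+k_m=t}}\ \sum_{\sigma\in\mathbb S_{(k_1,\dots,k_m,1,p-1-t)}}\frac{\varepsilon(\sigma)}{m!}T_{p-t}\Big(\rho_{m+1}\big(T_{k_1}(v_{\sigma(1)},\dots,v_{\sigma(k_1)}),\dots,T_{k_m}(v_{\sigma(k_1+\cdots+k_{m-1}+1)},\dots,v_{\sigma(t)}),v_{\sigma(t+1)}\big),v_{\sigma(t+2)},\dots,v_{\sigma(p)}\Big)$$ $$=\sum_{n\ge1,\ k_1+\cdots+k_n=p}\ \sum_{\sigma\in\mathbb S_{(k_1,\dots,k_n)}}\frac{\varepsilon(\sigma)}{n!}l_n\Big(T_{k_1}(v_{\sigma(1)},\dots,v_{\sigma(k_1)}),\dots,T_{k_n}(v_{\sigma(k_1+\cdots+k_{n-1}+1)},\dots,v_{\sigma(p)})\Big),$$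 with all $k_i\ge1$ (for $t=0$ one has $m=0$, giving terms $T_p(\rho_1(v_{\sigma(1)}),v_{\sigma(2)},\dots,v_{\sigma(p)})$). The $L_\infty$-algebra $\mathfrak h$: for a graded space $W$, let $C^n(W,W)=\mathrm{Hom}^n(\bar{\mathsf S}(W),W)$ (degree $n$ maps), $C^*(W,W)=\bigoplus_{n\in\mathbb Z}C^n(W,W)$, with the graded Nijenhuis-Richardson bracket $[f,g]_{NR}=f\bar\circ g-(-1)^{mn}g\bar\circ f$ ($f,g$ of degrees $m,n$), where for $f=\sum f_i$, $g=\sum g_j$, $f\bar\circ g=\sum_k\sum_{i+j=k+1}f_i\bar\circ g_j$ and $(f_i\bar\circ g_j)(w_1,\dots,w_{i+j-1})=\sum_{\sigma\in\mathbb S_{(j,i-1)}}\varepsilon(\sigma)f_i(g_j(w_{\sigma(1)},\dots,w_{\sigma(j)}),w_{\sigma(j+1)},\dots,w_{\sigma(i+j-1)})$. Take $W=\mathfrak g\oplus V$, $\mathfrak h=\bigoplus_{n\in\mathbb Z}\mathrm{Hom}^n(\bar{\mathsf S}(V),\mathfrak g)\subset C^*(W,W)$ (extended by zero), $P$ the natural projection of $C^*(W,W)$ onto $\mathfrak h$ (restrict to $\bar{\mathsf S}(V)$ and project to $\mathfrak g$), and $\Delta=\sum_{k\ge1}(l_k+\rho_k)$ the semidirect product $L_\infty$-structure on $\mathfrak g\oplus V$, whose $k$-th operation is $((x_1,v_1),\dots,(x_k,v_k))\mapsto(l_k(x_1,\dots,x_k),\sum_{i=1}^k(-1)^{x_i(x_{i+1}+\cdots+x_k)}\rho_k(x_1,\dots,\hat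 x_i,\dots,x_k,v_i))$. Then $\mathfrak l_k(a_1,\dots,a_k)=P[\cdots[[\Delta,a_1]_{NR},a_2]_{NR},\cdots,a_k]_{NR}$. A Maurer-Cartan element of $\mathfrak h$ is a degree $0$ element $T$ with $\sum_{k\ge1}\frac1{k!}\mathfrak l_k(T,\dots,T)=0$, where the sum converges because $\mathfrak l_k(T,\dots,T)$ has components only in $\mathrm{Hom}(\mathsf S^i(V),\mathfrak g)$ with $i\ge k$. *)

(* Defs.v *)
From HB Require Import structures.
From mathcomp Require Import all_boot all_order all_algebra perm.

Set Implicit Arguments.
Unset Strict Implicit.
Unset Printing Implicit Defensive.

Import Order.TTheory GRing.Theory Num.Theory.
Local Open Scope ring_scope.

(* A Z-graded vector space is the family of its homogeneous components. *)
Definition gspace (K : fieldType) := int -> lmodType K.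

Definition hvec (K : fieldType) (V : gspace K) := {n : int & V n}.

Definition hv (K : fieldType) (V : gspace K) (n : int) (x : V n) : hvec V :=
  Tagged V x.

Definition hdeg (K : fieldType) (V : gspace K) (x : hvec V) : int := tag x.

Definition degs (K : fieldType) (V : gspace K) (s : seq (hvec V)) : int :=
  \sum_(x <- s) hdeg x.

(* A linear map out of the tensor algebra of V is given by its values on
   sequences of homogeneous vectors: [f s m] is the component in W_m of
   f(s_1, ..., s_k), k = size s.  Thus one [f] encodes a whole family (f_k)_k,
   f_k being the restriction of [f] to the sequences of size k. *)
Definition mmap (K : fieldType) (V W : gspace K) :=
  seq (hvec V) -> forall m : int, W m.

Definition permute (T : Type) (s : seq T) (sigma : 'S_(size s)) : seq T :=
  [seq tnth (in_tuple s) (sigma i) | i <- enum 'I_(size s)].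

(* The sign with s_1 ... s_n = ksign s sigma . s_sigma(1) ... s_sigma(n) in the
   graded symmetric algebra: each inversion contributes (-1)^(product of the
   degrees of the two vectors exchanged). *)
Definition ksign (K : fieldType) (V : gspace K) (s : seq (hvec V))
    (sigma : 'S_(size s)) : K :=
  \prod_(i < size s) \prod_(j < size s | (i < j)%N && (sigma j < sigma i)%N)
     (-1) ^ (hdeg (tnth (in_tuple s) (sigma i))
             * hdeg (tnth (in_tuple s) (sigma j))).

Definition shuffle (ks : seq nat) (n : nat) (sigma : 'S_n) : bool :=
  [forall i : 'I_n, forall j : 'I_n,
     (i < j)%N && (reshape_index ks i == reshape_index ks j)
       ==> (sigma i < sigma j)%N].

(* \sum_(sigma in S_ks) epsilon(sigma) F(s_sigma(1), ..., s_sigma(n)); used only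
   with sumn ks = size s. *)
Definition shsum (K : fieldType) (V : gspace K) (U : lmodType K)
    (s : seq (hvec V)) (ks : seq nat) (F : seq (hvec V) -> U) : U :=
  \sum_(sigma : 'S_(size s) | shuffle ks sigma)
     ksign sigma *: F (permute sigma).

Definition multilinear (K : fieldType) (V W : gspace K) (f : mmap V W) : Prop :=
  forall (s1 s2 : seq (hvec V)) (n : int) (a : K) (x y : V n) (m : int),
    f (s1 ++ hv (a *: x + y) :: s2) m
      = a *: f (s1 ++ hv x :: s2) m + f (s1 ++ hv y :: s2) m.

Definition gsymmetric (K : fieldType) (V W : gspace K) (f : mmap V W) : Prop :=
  forall (s : seq (hvec V)) (sigma : 'S_(size s)) (m : int),
    f s m = ksign sigma *: f (permute sigma) m.

Definition has_degree (K : fieldType) (V W : gspace K) (n : int)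
    (f : mmap V W) : Prop :=
  forall (s : seq (hvec V)) (m : int), m != n + degs s -> f s m = 0.

(* f is in Hom^n(\bar S(V), W).  As \bar S(V) has no component S^0(V), the
   meaningless value of f on the empty sequence is normalised to 0. *)
Definition inHom (K : fieldType) (V W : gspace K) (n : int)
    (f : mmap V W) : Prop :=
  [/\ multilinear f, gsymmetric f, has_degree n f & forall m, f [::] m = 0].

(* The value f(s_1, ..., s_k), as a homogeneous vector, of f of degree n. *)
Definition hval (K : fieldType) (V W : gspace K) (n : int) (f : mmap V W)
    (s : seq (hvec V)) : hvec W :=
  hv (f s (n + degs s)).

Definition LInfty_algebra (K : fieldType) (g : gspace K) (l : mmap g g) : Prop :=
  inHom 1 l /\
  forall x : seq (hvec g), (1 <= size x)%N -> forall m : int,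
    \sum_(1 <= i < (size x).+1)
       shsum x [:: i; size x - i]%N
         (fun y => l (hval 1 l (take i y) :: drop i y) m) = 0.

(* Families of maps S^(k-1)(g) (x) V -> V, k = 1 + the size of the sequence. *)
Definition rmap (K : fieldType) (g V : gspace K) :=
  seq (hvec g) -> hvec V -> forall m : int, V m.

Definition rval (K : fieldType) (g V : gspace K) (rho : rmap g V)
    (x : seq (hvec g)) (v : hvec V) : hvec V :=
  hv (rho x v (1 + (degs x + hdeg v))).

Definition LInfty_representation (K : fieldType) (g V : gspace K) (l : mmap g g)
    (rho : rmap g V) : Prop :=
  [/\ forall v : hvec V, multilinear (fun x m => rho x v m : V m),
      forall (x : seq (hvec g)) (n : int) (a : K) (u v : V n) (m : int),
        rho x (hv (a *: u + v)) m = a *: rho x (hv u) m + rho x (hv v) m,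
      forall v : hvec V, gsymmetric (fun x m => rho x v m : V m),
      forall (x : seq (hvec g)) (v : hvec V) (m : int),
        m != 1 + (degs x + hdeg v) -> rho x v m = 0
    & forall (n : nat) (x : seq (hvec g)) (v : hvec V) (m : int),
        (1 <= n)%N -> size x = n.-1 ->
        \sum_(1 <= i < n)
           shsum x [:: i; n - i - 1]%N
             (fun y => rho (hval 1 l (take i y) :: drop i y) v m)
        + \sum_(1 <= i < n.+1)
            shsum x [:: n - i; i - 1]%N
              (fun y => (-1) ^ degs (take (n - i) y)
                 *: rho (take (n - i) y) (rval rho (drop (n - i) y) v) m)
        = 0].

(* The k-tuples of positive integers of sum t. *)
Definition compositions (k t : nat) : seq (seq nat) :=
  [seq ks <- [seq map val (val u) | u : k.-tuple 'I_t.+1]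
     | all (leq 1) ks && (sumn ks == t)].

Definition homotopy_relative_RB (K : fieldType) (g V : gspace K) (l : mmap g g)
    (rho : rmap g V) (T : mmap V g) : Prop :=
  inHom 0 T /\
  forall (p : nat) (v : seq (hvec V)) (d : int), (1 <= p)%N -> size v = p ->
    \sum_(0 <= t < p) \sum_(0 <= m < t.+1) \sum_(ks <- compositions m t)
       shsum v (ks ++ [:: 1; p - 1 - t]%N)
         (fun y => (m`!)%:R^-1 *:
            (if drop t y is w :: r then
               T (rval rho (map (hval 0 T) (reshape ks y)) w :: r) d
             else 0))
    = \sum_(1 <= n < p.+1) \sum_(ks <- compositions n p)
        shsum v ks
          (fun y => (n`!)%:R^-1 *: l (map (hval 0 T) (reshape ks y)) d).

(* Nijenhuis-Richardson: f \bar\circ g for g of degree n. *)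
Definition NRcirc (K : fieldType) (W : gspace K) (n : int) (f g : mmap W W)
    : mmap W W :=
  fun w d => \sum_(1 <= j < (size w).+1)
    shsum w [:: j; size w - j]%N
      (fun y => f (hval n g (take j y) :: drop j y) d).

(* A homogeneous cochain is paired with its degree, which the signs need. *)
Definition NRbracket (K : fieldType) (W : gspace K) (f g : int * mmap W W)
    : int * mmap W W :=
  (f.1 + g.1,
   fun w d => NRcirc g.1 f.2 g.2 w d
              - (-1) ^ (f.1 * g.1) *: NRcirc f.1 g.2 f.2 w d).

Definition gsum (K : fieldType) (g V : gspace K) : gspace K :=
  fun n => (g n * V n)%type.

Definition gfst (K : fieldType) (g V : gspace K) (w : hvec (gsum g V)) : hvec g :=
  hv (tagged w).1.

Definition gsnd (K : fieldType) (g V : gspace K) (w : hvec (gsum g V)) : hvec V :=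
  hv (tagged w).2.

Definition ginr (K : fieldType) (g V : gspace K) (v : hvec V) : hvec (gsum g V) :=
  @hv K (gsum g V) (hdeg v) (0, tagged v).

Definition semidirect (K : fieldType) (g V : gspace K) (l : mmap g g)
    (rho : rmap g V) : mmap (gsum g V) (gsum g V) :=
  fun w d =>
    let x := map (@gfst K g V) w in
    (l x d,
     \sum_(i < size w)
        let wi := tnth (in_tuple w) i in
        (-1) ^ (hdeg (gfst wi) * degs (drop i.+1 x))
          *: rho (take i x ++ drop i.+1 x) (gsnd wi) d).

(* Extension by zero of Hom(\bar S(V), g) into C^*(g (+) V, g (+) V). *)
Definition hext (K : fieldType) (g V : gspace K) (a : mmap V g)
    : mmap (gsum g V) (gsum g V) :=
  fun w d => (a (map (@gsnd K g V) w) d, 0).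

Definition hproj (K : fieldType) (g V : gspace K)
    (F : mmap (gsum g V) (gsum g V)) : mmap V g :=
  fun v d => (F (map (@ginr K g V) v) d).1.

(* l_k(a_1, ..., a_k) on homogeneous a_i (given with their degrees),
   k = size a. *)
Definition hbracket (K : fieldType) (g V : gspace K) (l : mmap g g)
    (rho : rmap g V) (a : seq (int * mmap V g)) : mmap V g :=
  hproj (foldl (@NRbracket K (gsum g V)) (1, semidirect l rho)
               [seq (b.1, hext b.2) | b <- a]).2.

(* Convergence of \sum_(k >= 1) u_k to S for the complete filtration of
   Hom(\bar S(V), W) by the maps vanishing on S^i(V) for all i <= p. *)
Definition series_converges (K : fieldType) (V W : gspace K)
    (u : nat -> mmap V W) (S : mmap V W) : Prop :=
  forall p : nat, exists N : nat, forall n : nat, (N <= n)%N ->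
    forall (v : seq (hvec V)) (d : int), (size v <= p)%N ->
      \sum_(1 <= k < n.+1) u k v d = S v d.

Definition Maurer_Cartan (K : fieldType) (g V : gspace K) (l : mmap g g)
    (rho : rmap g V) (T : mmap V g) : Prop :=
  inHom 0 T /\
  series_converges
    (fun k v d => (k`!)%:R^-1 *: hbracket l rho (nseq k (0, T)) v d)
    (fun _ _ => 0).

(* Main.v *)
Require Import Defs.
From HB Require Import structures.
From mathcomp Require Import all_boot all_order all_algebra perm.
Set Implicit Arguments.
Unset Strict Implicit.
Unset Printing Implicit Defensive.
Import Order.TTheory GRing.Theory Num.Theory.
Local Open Scope ring_scope.

(** Write Th for T extended by zero to g (+) V, and o for the
    Nijenhuis-Richardson composition.  The map Th takes its values in g and
    vanishes as soon as one of its arguments lies in g.  Hence the operators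
    insT : f |-> f o Th and applyT : f |-> Th o f commute ([insT_applyT]) and
    applyT squares to zero ([applyT_applyT]).  As T has degree 0, the bracket
    of f with Th is insT f - applyT f, so the k-fold bracket of Delta with Th
    is insT^k Delta - k applyT (insT^(k-1) Delta) ([iter_NRbracket]).

    Since Th o Th = 0, no two copies of Th are ever nested in insT^k f: it is
    the signed sum of f(Th(B_1), ..., Th(B_k), R) over all distributions of the
    arguments into nonempty blocks B_1, ..., B_k and a remainder R
    ([iter_insT]).  Now take all arguments in V and look at the g-component.
    In insT^k Delta only the term l_k(T(B_1), ..., T(B_k)) with R empty
    survives; in applyT (insT^m Delta) only the V-component of Delta matters,
    and it is rho_(m+1)(T(B_1), ..., T(B_m), w) when R is a single vector w and
    0 otherwise.  Dividing by k! turns the factor k into 1/(k-1)!, so that the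
    Maurer-Cartan series at v is, from its (size v)-th partial sum on, the
    right-hand side minus the left-hand side of the Rota-Baxter identity at v
    ([Maurer_Cartan_sum], [shsum_lT], [shsum_TrhoT]).

    Both sides are written as sums over permutations, which are awkward to
    nest.  The work is done instead with [unsum], the sum over all ways to
    distribute a sequence into two subsequences, that is, the coproduct of the
    graded symmetric coalgebra; its coassociativity and cocommutativity
    ([unsum_coassoc], [unsum_cocomm]) are all that the above manipulations
    need.  A sum over shuffles is an iterated coproduct ([shsumE]). *)

(** * Koszul signs and the unshuffle coproduct *)

Section Unshuffle.

Variables (K : fieldType) (X : Type) (dg : X -> int).

Definition dsum (s : seq X) : int := \sum_(x <- s) dg x.

Definition koszul (a b : seq X) : K := (-1) ^ (dsum a * dsum b).

Lemma dsum_cons x s : dsum (x :: s) = dg x + dsum s.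
Proof. exact: big_cons. Qed.

Lemma dsum_cat s t : dsum (s ++ t) = dsum s + dsum t.
Proof. exact: big_cat. Qed.

Lemma N1_neq0 : (-1 : K) != 0. Proof. by rewrite oppr_eq0 oner_eq0. Qed.

Lemma koszul_catl a b c : koszul (a ++ b) c = koszul a c * koszul b c.
Proof. by rewrite /koszul dsum_cat mulrDl expfzDr ?N1_neq0. Qed.

Lemma koszul_catr a b c : koszul a (b ++ c) = koszul a b * koszul a c.
Proof. by rewrite /koszul dsum_cat mulrDr expfzDr ?N1_neq0. Qed.

Lemma koszul0r a : koszul a [::] = 1.
Proof. by rewrite /koszul /dsum big_nil mulr0. Qed.

Lemma koszulC a b : koszul a b = koszul b a.
Proof. by rewrite /koszul mulrC. Qed.

Lemma koszulK a b : koszul a b * koszul a b = 1.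
Proof.
by rewrite /koszul -expfzMl mulrNN mulr1 exp1rz.
Qed.

(** Which splittings [unsum] below runs over; through it, every invariant of
    the two parts is proved by a single induction. *)
Inductive unshuffle : seq X -> seq X -> seq X -> Prop :=
| Unshuffle0 : unshuffle [::] [::] [::]
| UnshuffleL x s a b : unshuffle s a b -> unshuffle (x :: s) (x :: a) b
| UnshuffleR x s a b : unshuffle s a b -> unshuffle (x :: s) a (x :: b).

Lemma unshuffle_size s a b : unshuffle s a b -> (size s = size a + size b)%N.
Proof. by elim=> //= {a b s} x s a b _ ->; rewrite ?addnS. Qed.

Lemma unshuffle_dsum s a b : unshuffle s a b -> dsum s = dsum a + dsum b.
Proof.
elim=> [|x {}s {}a {}b _ IH|x {}s {}a {}b _ IH]; rewrite ?dsum_cons ?IH.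
- by rewrite /dsum big_nil addr0.
- by rewrite addrA.
- by rewrite addrCA.
Qed.

Lemma unshuffle_all s a b (p : pred X) :
  unshuffle s a b -> all p s = all p a && all p b.
Proof.
by elim=> //= {a b s} x s a b _ ->; [rewrite andbA|rewrite andbCA].
Qed.

Lemma unshuffle_pairwise s a b (r : rel X) :
  unshuffle s a b -> pairwise r s -> pairwise r a && pairwise r b.
Proof.
elim=> //= {a b s} x s a b us IH /andP[]; rewrite (unshuffle_all _ us).
  by case/andP=> -> _ /IH.
by case/andP=> _ -> /IH.
Qed.

(** The unshuffle coproduct: \sum epsilon G(a, b) over all subsequences a of s
    with complement b.  The first vector x goes either to a, at no cost, or to
    b, and then it has been moved past the whole of a. *)
Fixpoint unsum (U : lmodType K) (s : seq X) (G : seq X -> seq X -> U) : U :=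
  if s is x :: s' then
    unsum s' (fun a b => G (x :: a) b + koszul [:: x] a *: G a (x :: b))
  else G [::] [::].

Section UnsumTheory.
Variable U : lmodType K.
Implicit Types (s : seq X) (G H : seq X -> seq X -> U).

Lemma eq_unsum s G H :
  (forall a b, unshuffle s a b -> G a b = H a b) -> unsum s G = unsum s H.
Proof.
elim: s G H => [|x s IH] G H eGH /=; first by apply: eGH; constructor.
by apply: IH => a b us; rewrite !eGH //; constructor.
Qed.

Lemma unsum_linear c s G H :
  unsum s (fun a b => c *: G a b + H a b) = c *: unsum s G + unsum s H.
Proof.
elim: s G H => [|x s IH] G H //=; rewrite -IH.
apply: eq_unsum => a b _; rewrite !scalerDr !scalerA.
by rewrite -!addrA [koszul _ _ * c]mulrC; congr (_ + _); rewrite addrCA.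
Qed.

Lemma unsumD s G H :
  unsum s (fun a b => G a b + H a b) = unsum s G + unsum s H.
Proof.
rewrite -[unsum s G]scale1r -unsum_linear.
by apply: eq_unsum => a b _; rewrite scale1r.
Qed.

Lemma unsum0 s : unsum s (fun _ _ => 0 : U) = 0.
Proof.
rewrite -[RHS](subrr (unsum s (fun _ _ => 0 : U))) -scaleN1r addrC -unsum_linear.
by apply: eq_unsum => a b _; rewrite scaler0 addr0.
Qed.

Lemma unsumZ c s G : unsum s (fun a b => c *: G a b) = c *: unsum s G.
Proof.
rewrite -[RHS]addr0 -(unsum0 s) -unsum_linear.
by apply: eq_unsum => a b _; rewrite addr0.
Qed.

Lemma unsum_eq0 s G :
  (forall a b, unshuffle s a b -> G a b = 0) -> unsum s G = 0.
Proof. by move=> G0; rewrite -(unsum0 s); apply: eq_unsum. Qed.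

Lemma unsum_sum s I (r : seq I) (P : pred I) (G : I -> seq X -> seq X -> U) :
  unsum s (fun a b => \sum_(i <- r | P i) G i a b)
    = \sum_(i <- r | P i) unsum s (G i).
Proof.
elim: r => [|i r IH].
  by rewrite big_nil; apply: unsum_eq0 => *; rewrite big_nil.
rewrite big_cons; case: ifP => Pi; last first.
  by rewrite -IH; apply: eq_unsum => *; rewrite big_cons Pi.
by rewrite -IH -unsumD; apply: eq_unsum => *; rewrite big_cons Pi.
Qed.

Lemma unsum_coassoc s (G : seq X -> seq X -> seq X -> U) :
  unsum s (fun p c => unsum p (fun a b => G a b c))
    = unsum s (fun a p => unsum p (fun b c => G a b c)).
Proof.
elim: s G => [|x s IH] G //=; rewrite !unsumD.
(* The first vector x goes to the first, the second or the third part. *)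
pose G1 a b c := G (x :: a) b c.
pose G2 a b c := koszul [:: x] a *: G a (x :: b) c.
pose G3 a b c := koszul [:: x] (a ++ b) *: G a b (x :: c).
transitivity (unsum s (fun p c => unsum p (fun a b => G1 a b c + G2 a b c))
   + unsum s (fun p c => unsum p (fun a b => G3 a b c))).
  congr (_ + _); apply: eq_unsum => p c _; rewrite -unsumZ.
  apply: eq_unsum => a b us; rewrite /G3 /koszul.
  by rewrite (unshuffle_dsum us) dsum_cat.
rewrite IH IH.
transitivity (unsum s (fun a p => unsum p (G1 a)) + (unsum s (fun a p =>
   unsum p (G2 a)) + unsum s (fun a p => unsum p (G3 a)))).
  rewrite addrA -[in RHS]unsumD; congr (_ + _); apply: eq_unsum => a p _.
  by rewrite -unsumD.
congr (_ + _); rewrite -unsumD; apply: eq_unsum => a p _.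
rewrite -unsumD -unsumZ; apply: eq_unsum => b c _.
by rewrite /G2 /G3 scalerDr scalerA -koszul_catr.
Qed.

Lemma unsum_cocomm s G :
  unsum s (fun a b => koszul a b *: G b a) = unsum s G.
Proof.
elim: s G => [|x s IH] G //=; first by rewrite koszul0r scale1r.
rewrite -[RHS]IH; apply: eq_unsum => a b _.
rewrite scalerDr !scalerA addrC; congr (_ *: _ + _ *: _).
  rewrite -[x :: b]/([:: x] ++ b) koszul_catr mulrA [koszul [:: x] a]koszulC.
  by rewrite koszulK mul1r.
by rewrite -[x :: a]/([:: x] ++ a) koszul_catl mulrC.
Qed.

(** Coassociativity and cocommutativity combined: two parts extracted one
    after the other may be extracted in the opposite order. *)
Lemma unsum_swap s (G : seq X -> seq X -> seq X -> U) :
  unsum s (fun a p => unsum p (fun b c => koszul a b *: G a b c))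
    = unsum s (fun b p => unsum p (fun a c => G a b c)).
Proof.
rewrite -!unsum_coassoc; apply: eq_unsum => p c _.
exact: (unsum_cocomm p (fun b a => G a b c)).
Qed.

Lemma unsum_full s (G : seq X -> seq X -> U) :
  unsum s (fun a b => if size a == size s then G a b else 0) = G s [::].
Proof.
elim: s G => [|x s IH] G //=.
rewrite -[RHS](IH (fun a b => G (x :: a) b)).
apply: eq_unsum => a b us; rewrite eqSS [X in _ + X](_ : _ = 0) ?addr0 //.
by rewrite (unshuffle_size us) ifN ?scaler0 // neq_ltn ltnS leq_addr.
Qed.

End UnsumTheory.

Lemma unsum_morph (U U' : lmodType K) (f : U -> U') s G :
  (forall c x y, f (c *: x + y) = c *: f x + f y) ->
  f (unsum s G) = unsum s (fun a b => f (G a b)).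
Proof.
move=> fl; have fD x y : f (x + y) = f x + f y.
  by rewrite -[x]scale1r fl !scale1r.
elim: s G => [|x s IH] G //=; rewrite IH; apply: eq_unsum => a b _.
by rewrite addrC fl addrC.
Qed.

End Unshuffle.

Lemma unsum_map (K : fieldType) (X Y : Type) (dX : X -> int) (dY : Y -> int)
    (h : X -> Y) (U : lmodType K) (s : seq X) (G : seq Y -> seq Y -> U) :
  (forall x, dY (h x) = dX x) ->
  unsum dY (map h s) G = unsum dX s (fun a b => G (map h a) (map h b)).
Proof.
move=> dh; elim: s G => [|x s IH] G //=; rewrite IH; apply: eq_unsum => a b _.
rewrite /= /koszul /dsum !big_cons !big_nil dh big_map.
by under [in LHS]eq_bigr do rewrite dh.
Qed.

(** * Sums over permutations *)

Section PermutationSums.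

Variables (K : fieldType) (X : Type) (dg : X -> int).
Local Notation dsum := (dsum dg).
Local Notation koszul := (koszul K dg).
Local Notation unsum := (@unsum K X dg _).

Fixpoint inssum (U : lmodType K) (x : X) (z : seq X) (G : seq X -> U) : U :=
  G (x :: z) + (if z is y :: z' then
                  koszul [:: x] [:: y] *: inssum x z' (fun t => G (y :: t))
                else 0).

(** The signed sum over all rearrangements of s, each obtained in exactly one
    way by inserting the vectors of s one by one, from last to first. *)
Fixpoint permsum (U : lmodType K) (s : seq X) (G : seq X -> U) : U :=
  if s is x :: s' then permsum s' (fun z => inssum x z G) else G [::].

(** The deconcatenation coproduct, dual to concatenation. *)
Fixpoint cutsum (U : lmodType K) (z : seq X) (G : seq X -> seq X -> U) : U :=
  G [::] z + (if z is y :: z' then cutsum z' (fun a b => G (y :: a) b) else 0).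

Section Theory.
Variable U : lmodType K.

Lemma inssumE x z (G : seq X -> U) :
  inssum x z G = \sum_(p < (size z).+1)
     koszul [:: x] (take p z) *: G (take p z ++ x :: drop p z).
Proof.
elim: z G => [|y z IH] G /=.
  by rewrite big_ord_recl big_ord0 koszul0r scale1r.
rewrite big_ord_recl /= koszul0r scale1r; congr (_ + _).
rewrite IH scaler_sumr; apply: eq_bigr => p _.
by rewrite scalerA -koszul_catr.
Qed.

Lemma inssum_linear x z c (G H : seq X -> U) :
  inssum x z (fun t => c *: G t + H t) = c *: inssum x z G + inssum x z H.
Proof.
rewrite !inssumE scaler_sumr -big_split; apply: eq_bigr => p _ /=.
by rewrite scalerDr !scalerA mulrC.
Qed.

Lemma eq_inssum x z (G H : seq X -> U) :
  (forall t, dsum t = dg x + dsum z -> size t = (size z).+1 ->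
     (forall P, all P t = P x && all P z) -> G t = H t) ->
  inssum x z G = inssum x z H.
Proof.
move=> GH; rewrite !inssumE; apply: eq_bigr => p _; congr (_ *: _).
apply: GH => [||P].
- by rewrite dsum_cat dsum_cons addrCA -dsum_cat cat_take_drop.
- by rewrite size_cat /= addnS -size_cat cat_take_drop.
- by rewrite all_cat /= andbCA -all_cat cat_take_drop.
Qed.

Lemma eq_permsum s (G H : seq X -> U) :
  (forall t, dsum t = dsum s -> size t = size s ->
     (forall P, all P t = all P s) -> G t = H t) ->
  permsum s G = permsum s H.
Proof.
elim: s G H => [|x s IH] G H GH /=; first exact: GH.
apply: IH => z dz sz az; apply: eq_inssum => t dt st at_.
apply: GH => [||P]; rewrite ?dsum_cons ?dt ?dz ?st ?sz //=.
by rewrite at_ az.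
Qed.

Lemma permsum_linear s c (G H : seq X -> U) :
  permsum s (fun t => c *: G t + H t) = c *: permsum s G + permsum s H.
Proof.
elim: s G H => [|x s IH] G H //=; rewrite -IH.
by apply: eq_permsum => *; rewrite inssum_linear.
Qed.

Lemma permsum_eq0 s (G : seq X -> U) :
  (forall t, dsum t = dsum s -> size t = size s ->
     (forall P, all P t = all P s) -> G t = 0) -> permsum s G = 0.
Proof.
move=> G0; transitivity (permsum s (fun t => (-1) *: G t + G t)).
  by apply: eq_permsum => t *; rewrite G0 // scaler0 addr0.
by rewrite permsum_linear scaleN1r addNr.
Qed.

Lemma cutsum_linear z c (G H : seq X -> seq X -> U) :
  cutsum z (fun a b => c *: G a b + H a b) = c *: cutsum z G + cutsum z H.
Proof.
elim: z G H => [|y z IH] G H /=; first by rewrite !addr0.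
by rewrite IH scalerDr addrACA.
Qed.

Lemma eq_cutsum z (G H : seq X -> seq X -> U) :
  (forall a b, a ++ b = z -> G a b = H a b) -> cutsum z G = cutsum z H.
Proof.
elim: z G H => [|y z IH] G H GH /=; rewrite GH //; congr (_ + _).
by apply: IH => a b ab; apply: GH; rewrite /= ab.
Qed.

Lemma cutsumE z n (G : seq X -> seq X -> U) : (n <= size z)%N ->
  cutsum z (fun a b => if size a == n then G a b else 0)
    = G (take n z) (drop n z).
Proof.
elim: z n G => [|y z IH] [|n] G //= lenz; rewrite ?addr0 ?add0r //.
  rewrite -[RHS]addr0; congr (_ + _).
  transitivity (cutsum z (fun _ _ => (-1) *: (0 : U) + 0)).
    by apply: eq_cutsum => *; rewrite scaler0 addr0.
  by rewrite cutsum_linear scaleN1r addNr.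
by rewrite -(IH n (fun a b => G (y :: a) b)).
Qed.

Lemma inssum_cut x z (G : seq X -> seq X -> U) :
  inssum x z (fun t => cutsum t G)
    = cutsum z (fun a b => koszul [:: x] a *: inssum x b (G a)
                           + inssum x a (fun t => G t b)).
Proof.
elim: z G => [|y z IH] G /=; first by rewrite !addr0 koszul0r scale1r.
rewrite koszul0r scale1r !addr0.
pose I0 := inssum x z (fun t => G [::] (y :: t)).
pose C1 := cutsum z (fun a b => koszul [:: x] a *: inssum x b (G (y :: a))
                       + inssum x a (fun t => G (y :: t) b)).
have ->: inssum x z (fun t => G [::] (y :: t)
             + cutsum t (fun a b => G (y :: a) b)) = I0 + C1.
  rewrite /C1 -IH -[I0]scale1r -inssum_linear; apply: eq_inssum => t *.
  by rewrite scale1r.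
have ->: cutsum z (fun a b =>
   koszul [:: x] (y :: a) *: inssum x b (G (y :: a)) +
   (G [:: x, y & a] b +
    koszul [:: x] [:: y] *: inssum x a (fun t => G (y :: t) b)))
  = koszul [:: x] [:: y] *: C1 + cutsum z (fun a b => G [:: x, y & a] b).
  rewrite -cutsum_linear; apply: eq_cutsum => a b _.
  rewrite -[y :: a]/([:: y] ++ a) koszul_catr /= scalerDr scalerA -addrA.
  by congr (_ + _); rewrite addrC.
rewrite scalerDr -!addrA; congr (_ + _).
by rewrite [RHS]addrCA; congr (_ + _); rewrite [LHS]addrC -addrA.
Qed.

Lemma inssum_permsum x z s (G : seq X -> seq X -> U) :
  inssum x z (fun t => permsum s (G t))
    = permsum s (fun t' => inssum x z (fun t => G t t')).
Proof.
elim: z G => [|y z IH] G /=.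
  by rewrite addr0; apply: eq_permsum => *; rewrite addr0.
rewrite IH addrC -permsum_linear.
by apply: eq_permsum => *; rewrite addrC.
Qed.

(** Rearranging s and cutting the result amounts to choosing the set of
    vectors before the cut and rearranging both parts: the symmetrisation
    is a morphism from the unshuffle to the deconcatenation coproduct. *)
Lemma permsum_cut s (G : seq X -> seq X -> U) :
  permsum s (fun z => cutsum z G)
    = unsum s (fun a b => permsum a (fun z1 => permsum b (G z1))).
Proof.
elim: s G => [|x s IH] G /=; first by rewrite addr0.
transitivity (permsum s (fun z =>
    cutsum z (fun a b => koszul [:: x] a *: inssum x b (G a)
                           + inssum x a (fun t => G t b)))).
  by apply: eq_permsum => z *; rewrite inssum_cut.
rewrite IH; apply: eq_unsum => a b _; rewrite addrC -permsum_linear.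
apply: eq_permsum => z1 dz1 _ _; rewrite permsum_linear inssum_permsum.
by rewrite /koszul dz1.
Qed.

(** The identity is the only rearrangement of a strictly increasing sequence
    that is increasing; this is what makes a block of a shuffle rigid. *)
Lemma permsum_sorted (r : rel X) s (G : seq X -> U) :
  (forall x y, r x y -> ~~ r y x) -> pairwise r s ->
  permsum s (fun z => if pairwise r z then G z else 0) = G s.
Proof.
move=> rN; elim: s G => [|x s IH] G //= /andP[rx rs].
rewrite -(IH (fun z => G (x :: z))) //; apply: eq_permsum => z _ _ az.
(* Inserted anywhere but in front, x comes after a larger element. *)
rewrite inssumE big_ord_recl big1 /=.
  by rewrite addr0 take0 drop0 koszul0r scale1r /= az rx.
move=> p _; case: z az p => [|y z] az p; first by case: p.
rewrite /bump add1n /= all_cat /=.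
have: r x y by move: (az (r x)); rewrite rx => /andP[].
by move=> /rN /negPf ->; rewrite andbF scaler0.
Qed.

End Theory.
End PermutationSums.

(** * Shuffles as permutations *)

(** A permutation is determined by the position p of 0 and by the order of
    the other values. *)
Lemma sum_lift_perm (U : zmodType) n (H : 'S_n.+1 -> U) :
  \sum_(s : 'S_n.+1) H s
    = \sum_(t : 'S_n) \sum_(p < n.+1) H (lift_perm p ord0 t).
Proof.
rewrite pair_big /= (reindex (fun u : 'S_n * 'I_n.+1 => lift_perm u.2 ord0 u.1)) //=.
apply: onW_bij; apply: inj_card_bij; last first.
  by rewrite card_prod !card_Sn card_ord factS mulnC.
move=> [t p] [t' p'] /= ett'.
have epp' : p = p'.
  apply: (@perm_inj _ (lift_perm p ord0 t)).
  by rewrite lift_perm_id ett' lift_perm_id.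
rewrite -{}epp' in ett' *; congr (_, _); apply/permP => k.
apply: (@lift_inj _ ord0).
by rewrite -(lift_perm_lift p) ett' lift_perm_lift.
Qed.

Lemma map_lift_perm (T : Type) n (f : 'I_n.+1 -> T) (p : 'I_n.+1) (t : 'S_n)
    (z := [seq f (lift ord0 (t i)) | i <- enum 'I_n]) :
  [seq f (lift_perm p ord0 t i) | i <- enum 'I_n.+1]
    = take p z ++ f ord0 :: drop p z.
Proof.
have sz : size z = n by rewrite size_map size_enum_ord.
apply: (@eq_from_nth _ (f ord0)).
  rewrite size_map size_enum_ord size_cat /= addnS -size_cat cat_take_drop.
  by rewrite sz.
rewrite size_map size_enum_ord => i lti.
rewrite (nth_map ord0) ?size_enum_ord //.
have stp : size (take p z) = p by rewrite size_takel // sz -ltnS.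
rewrite nth_cat stp; case: (unliftP p (Ordinal lti)) => [k|] ei; last first.
  have {1 2}->: i = p by move/(congr1 val): ei.
  rewrite (_ : nth _ _ _ = p) ?lift_perm_id.
    by move/(congr1 val): ei => /= ->; rewrite ltnn subnn.
  by apply: val_inj; rewrite /= nth_enum_ord.
have -> : nth ord0 (enum 'I_n.+1) i = lift p k.
  by rewrite -ei; apply: val_inj; rewrite /= nth_enum_ord.
have -> : i = bump p k by move/(congr1 val): ei.
have ek : nth k (enum 'I_n) k = k.
  by apply: val_inj; rewrite /= nth_enum_ord.
rewrite lift_perm_lift /bump; case: (leqP p k) => pk.
  rewrite add1n ltnNge leqW //= subSn //= nth_drop subnKC //.
  by rewrite (nth_map k) ?size_enum_ord // ek.
by rewrite add0n pk nth_take // (nth_map k) ?size_enum_ord // ek.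
Qed.

Section Koszul.
Variables (K : fieldType) (V : gspace K).
Local Notation dV := (@hdeg K V).

Lemma koszul_prod x (s : seq (hvec V)) :
  koszul K dV [:: x] s = \prod_(y <- s) (-1) ^ (hdeg y * hdeg x).
Proof.
elim: s => [|y s IH]; first by rewrite koszul0r big_nil.
rewrite big_cons -IH -[y :: s]/([:: y] ++ s) koszul_catr; congr (_ * _).
by rewrite /koszul /dsum !big_seq1 mulrC.
Qed.

Lemma size_permute (s : seq (hvec V)) (t : 'S_(size s)) :
  size (permute t) = size s.
Proof. by rewrite size_map size_enum_ord. Qed.

Lemma permute_lift x (s : seq (hvec V)) (p : 'I_(size s).+1)
    (t : 'S_(size s)) :
  @permute _ (x :: s) (lift_perm p ord0 t)
    = take p (permute t) ++ x :: drop p (permute t).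
Proof.
rewrite /permute /=.
rewrite (map_lift_perm (fun i => tnth (in_tuple (x :: s)) i)).
set z1 := [seq _ | i <- _]; set z2 := [seq _ | i <- _].
rewrite (_ : z1 = z2) //; apply: eq_map => i.
by rewrite !(tnth_nth x).
Qed.

(** The inversions created by inserting the smallest value at position p are
    those with the p values that precede it. *)
Lemma ksign_lift x (s : seq (hvec V)) (p : 'I_(size s).+1)
    (t : 'S_(size s)) :
  @ksign _ _ (x :: s) (lift_perm p ord0 t)
    = ksign t * koszul K dV [:: x] (take p (permute t)).
Proof.
(* No value is smaller than 0: position p contributes no inversion to its right. *)
rewrite /ksign (bigD1_ord p) //= lift_perm_id [X in X * _]big1 ?mul1r; last first.
  by move=> j /andP[]; rewrite ltn0.
have ->: koszul K dV [:: x] (take p (permute t))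
   = \prod_(i < size s | (i < p)%N)
       (-1) ^ (hdeg (tnth (in_tuple s) (t i)) * hdeg x).
  rewrite koszul_prod (big_nth x) size_takel ?size_permute -1?ltnS //.
  rewrite big_mkord (big_ord_widen (size s) (fun i =>
    (-1) ^ (hdeg (nth x (take p (permute t)) i) * hdeg x))) -1?ltnS //.
  apply: eq_bigr => i ip; congr (_ ^ (hdeg _ * _)).
  rewrite nth_take // /permute (nth_map i) ?size_enum_ord //.
  by congr (tnth _ (t _)); apply: val_inj; rewrite /= nth_enum_ord.
rewrite [X in _ * X]big_mkcond -big_split /=; apply: eq_bigr => i _.
have tE (j : 'I_(size s)) :
  tnth (in_tuple (x :: s)) (lift ord0 j) = tnth (in_tuple s) j.
  by rewrite !(tnth_nth x).
rewrite big_mkcond (bigD1_ord p) //= lift_perm_id lift_perm_lift !tE mulrC.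
have pE : (bump p i < p)%N = (i < p)%N.
  by rewrite /bump; case: (leqP p i) => pi; rewrite ?add1n ?add0n // ltnNge leqW.
congr (_ * _); last by rewrite andbT pE.
rewrite [RHS]big_mkcond; apply: eq_bigr => j _.
rewrite !lift_perm_lift tE.
have bE (a b : nat) : (bump p a < bump p b)%N = (a < b)%N.
  by rewrite !ltnNge leq_bump2.
by rewrite bE /= /bump !leq0n !add1n ltnS.
Qed.

(** The values of the permutation are passed to G next to the permuted
    vectors, because being a shuffle is a condition on these values.  The
    shift k is there for the induction. *)
Lemma sum_permsum (U : lmodType K) (s : seq (hvec V)) k
    (G : seq nat -> seq (hvec V) -> U) :
  \sum_(sg : 'S_(size s)) ksign sg *:
     G [seq (k + val (sg i))%N | i <- enum 'I_(size s)] (permute sg)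
    = permsum (fun z : nat * hvec V => dV z.2) (zip (iota k (size s)) s)
        (fun z => G (unzip1 z) (unzip2 z)).
Proof.
elim: s k G => [|x s IH] k G.
  rewrite /= (big_pred1 (1%g : 'S_0)) => [|sg]; last first.
    by apply/esym/eqP/permP => -[].
  by rewrite /ksign big_ord0 scale1r /permute !enum_ord0.
pose G' is_ ys := \sum_(p < (size ys).+1) koszul K dV [:: x] (take p ys)
  *: G (take p is_ ++ k :: drop p is_) (take p ys ++ x :: drop p ys).
rewrite [RHS](_ : _ = permsum (fun z : nat * hvec V => dV z.2)
    (zip (iota k.+1 (size s)) s) (fun z => G' (unzip1 z) (unzip2 z))); last first.
  rewrite /=; apply: eq_permsum => z _ _ _; rewrite inssumE /G' size_map.
  apply: eq_bigr => p _; rewrite /unzip1 /unzip2 !map_cat /= !map_take !map_drop.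
  congr (_ *: _); rewrite /koszul /dsum !big_seq1 /= -map_take big_map.
  by [].
rewrite -IH sum_lift_perm; apply: eq_bigr => t _.
rewrite /G' size_permute scaler_sumr; apply: eq_bigr => p _.
rewrite ksign_lift permute_lift scalerA; congr (_ *: G _ _).
rewrite (map_lift_perm (fun i => k + val i)%N) addn0.
have -> // : [seq (k + val (lift ord0 (t i)))%N | i <- enum 'I_(size s)]
  = [seq (k.+1 + val (t i))%N | i <- enum 'I_(size s)].
by apply: eq_map => i; rewrite /= /bump addnA addn1.
Qed.
End Koszul.

Lemma reshape_index_cons j ks i :
  reshape_index (j :: ks) i
    = if (i < j)%N then 0%N else (reshape_index ks (i - j)).+1.
Proof.
by rewrite /reshape_index /= subn_eq0; case: ltnP => // ji; rewrite subSn.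
Qed.

Lemma all_pairwise_reshape (r : rel nat) ks t :
  size t = sumn ks ->
  reflect (forall i j, (i < j < size t)%N ->
             reshape_index ks i = reshape_index ks j ->
             r (nth 0%N t i) (nth 0%N t j))
          (all (pairwise r) (reshape ks t)).
Proof.
elim: ks t => [|k ks IH] t /= szt.
  by left=> i j; rewrite szt ltn0 andbF.
have szd : size (drop k t) = sumn ks by rewrite size_drop szt addKn.
have kt : (k <= size t)%N by rewrite szt leq_addr.
apply: (iffP andP) => [[/(pairwiseP 0%N) pt /(IH _ szd) pd] i j /andP[ij jt]|P].
  rewrite !reshape_index_cons; case: (ltnP j k) => [jk|kj].
    rewrite (ltn_trans ij jk) => _.
    have := pt i j; rewrite !nth_take ?(ltn_trans ij jk) // => -> //;
      by rewrite inE size_takel // (ltn_trans ij jk).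
  case: (ltnP i k) => [//|ki [/pd]].
  rewrite !nth_drop !subnKC //; apply.
  by rewrite ltn_sub2rE // ij size_drop ltn_sub2r // (leq_ltn_trans kj jt).
split.
  apply/(pairwiseP 0%N) => i j; rewrite !inE size_takel // => ik jk ij.
  rewrite !nth_take //; apply: P; first by rewrite ij (leq_trans jk).
  by rewrite !reshape_index_cons ik jk.
apply/(IH _ szd) => i j; rewrite size_drop => /andP[ij jt] rij.
rewrite !nth_drop; apply: P; first by rewrite ltn_add2l ij -ltn_subRL.
by rewrite !reshape_index_cons !ltnNge !leq_addr /= !addKn rij.
Qed.

(** The form of the shuffle condition that is stable under cutting off the
    first block, as needed for inductions on ks. *)
Lemma shuffleE ks n (sg : 'S_n) : sumn ks = n ->
  shuffle ks sg
    = all (pairwise ltn) (reshape ks [seq val (sg i) | i <- enum 'I_n]).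
Proof.
move=> sks; set t := [seq _ | i <- _].
have st : size t = n by rewrite size_map size_enum_ord.
have nt (i : 'I_n) : nth 0%N t i = sg i.
  rewrite (nth_map i) ?size_enum_ord //; congr (val (sg _)).
  by apply: val_inj; rewrite /= nth_enum_ord.
apply/idP/idP => [/forallP P|].
  apply/all_pairwise_reshape; rewrite ?st // => i j /andP[ij jn] rij.
  have lin := ltn_trans ij jn.
  move: (P (Ordinal lin)) => /forallP/(_ (Ordinal jn)).
  by rewrite /= ij rij eqxx /= -!nt.
move/(all_pairwise_reshape _ (etrans st (esym sks))) => P.
apply/forallP => i; apply/forallP => j; apply/implyP => /andP[ij /eqP rij].
by rewrite -!nt; apply: P; rewrite ?ij ?st /=.
Qed.

(** * Iterated coproducts and compositions *)

Section Blocks.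

Variables (K : fieldType) (X : Type) (dg : X -> int).
Local Notation dsum := (dsum dg).
Local Notation koszul := (koszul K dg).
Local Notation unsum := (@unsum K X dg _).
Local Notation permsum := (@permsum K X dg _).

(** Iterated coproduct extracting blocks of the sizes prescribed by ks; P
    receives the list of blocks and the remainder. *)
Fixpoint chain (U : lmodType K) (ks : seq nat) (s : seq X)
    (P : seq (seq X) -> seq X -> U) : U :=
  if ks is j :: ks' then
    unsum s (fun a b =>
      if size a == j then chain ks' b (fun bl r => P (a :: bl) r) else 0)
  else P [::] s.

(** The sum of all the [chain]s with k nonempty blocks; see
    [blocksum_compositions]. *)
Fixpoint blocksum (U : lmodType K) (k : nat) (s : seq X)
    (P : seq (seq X) -> seq X -> U) : U :=
  if k is k'.+1 then
    unsum s (fun a b =>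
      if nilp a then 0 else blocksum k' b (fun bl r => P (a :: bl) r))
  else P [::] s.

Section Theory.
Variable U : lmodType K.
Implicit Types (s : seq X) (P Q : seq (seq X) -> seq X -> U).

Lemma eq_chain ks s P Q :
  (forall bl r, shape bl = ks -> dsum s = dsum (flatten bl) + dsum r ->
     size s = (sumn ks + size r)%N -> P bl r = Q bl r) ->
  chain ks s P = chain ks s Q.
Proof.
elim: ks s P Q => [|j ks IH] s P Q PQ /=; first by rewrite PQ // /dsum big_nil add0r.
apply: eq_unsum => a b us; case: eqP => // sa; apply: IH => bl r sbl db sb.
apply: PQ => [|| /=]; rewrite ?/shape /= -?/(shape _) ?sa ?sbl //.
  by rewrite dsum_cat (unshuffle_dsum dg us) db addrA.
by rewrite (unshuffle_size us) sa sb addnA.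
Qed.

Lemma chain_cat ks1 ks2 s P :
  chain (ks1 ++ ks2) s P
    = chain ks1 s (fun bl r => chain ks2 r (fun bl' r' => P (bl ++ bl') r')).
Proof.
elim: ks1 s P => [|j ks1 IH] s P //=.
by apply: eq_unsum => a b _; rewrite IH.
Qed.

(** By [permsum_cut] the blocks of a shuffle can be chosen first and arranged
    afterwards, and by [permsum_sorted] there is one way to arrange each. *)
Lemma permsum_chain (r : rel X) q ks (F : seq X -> U) :
  (forall x y, r x y -> ~~ r y x) -> pairwise r q -> sumn ks = size q ->
  permsum q (fun z => if all (pairwise r) (reshape ks z) then F z else 0)
    = chain ks q (fun bl b => F (flatten bl ++ b)).
Proof.
move=> rN; elim: ks q F => [|j ks IH] q F rq sq /=.
  by case: q rq sq.
transitivity (permsum q (fun z => cutsum z (fun a b => if size a == j then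
   (if pairwise r a then if all (pairwise r) (reshape ks b) then F (a ++ b)
    else 0 else 0) else 0))).
  apply: eq_permsum => z _ sz _; rewrite cutsumE ?sz -?sq ?leq_addr //.
  by case: (pairwise r _); rewrite //= cat_take_drop.
rewrite permsum_cut; apply: eq_unsum => a b us.
have /andP[ra rb] := unshuffle_pairwise us rq.
transitivity (permsum a (fun z => if pairwise r z then
   (if size a == j then chain ks b (fun bl c => F (z ++ flatten bl ++ c))
    else 0) else 0)); last first.
  rewrite permsum_sorted //; case: eqP => // _; apply: eq_chain => bl c *.
  by rewrite /= catA.
apply: eq_permsum => z _ sz _; rewrite sz; case: eqP => sa; last first.
  by rewrite permsum_eq0 //; case: ifP.
case: (pairwise r z); last by rewrite permsum_eq0.
rewrite -(IH _ (fun c => F (z ++ c))) //.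
by apply/eqP; rewrite -(eqn_add2l j) -{2}sa -(unshuffle_size us) -sq.
Qed.

Lemma eq_blocksum k s P Q :
  (forall bl r, size bl = k -> (k + size r <= size s)%N ->
     dsum s = dsum (flatten bl) + dsum r -> P bl r = Q bl r) ->
  blocksum k s P = blocksum k s Q.
Proof.
elim: k s P Q => [|k IH] s P Q PQ /=; first by rewrite PQ // /dsum big_nil add0r.
apply: eq_unsum => a b us; case: ifP => // na; apply: IH => bl r sbl sb db.
apply: PQ => [|| /=]; rewrite /= ?sbl //.
  rewrite (unshuffle_size us) addSn -add1n leq_add //.
  by case: (a) na.
by rewrite dsum_cat (unshuffle_dsum dg us) db addrA.
Qed.

Lemma blocksum_linear k s c P Q :
  blocksum k s (fun bl r => c *: P bl r + Q bl r)
    = c *: blocksum k s P + blocksum k s Q.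
Proof.
elim: k s P Q => [|k IH] s P Q //=; rewrite -unsum_linear.
by apply: eq_unsum => a b _; rewrite IH; case: ifP => //; rewrite scaler0 addr0.
Qed.

Lemma blocksum_eq0 k s P :
  (forall bl r, size bl = k -> (k + size r <= size s)%N ->
     dsum s = dsum (flatten bl) + dsum r -> P bl r = 0) ->
  blocksum k s P = 0.
Proof.
move=> P0; transitivity (blocksum k s (fun bl r => (-1) *: P bl r + P bl r)).
  by apply: eq_blocksum => bl r *; rewrite P0 // scaler0 addr0.
by rewrite blocksum_linear scaleN1r addNr.
Qed.

(** Coassociativity: splitting s into a and b, then extracting the blocks from
    a, is the same as extracting the blocks from s and splitting what is left. *)
Lemma unsum_blocksum k s (Q : seq (seq X) -> seq X -> seq X -> U) :
  unsum s (fun a b => blocksum k a (fun bl r => Q bl r b))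
    = blocksum k s (fun bl r => unsum r (Q bl)).
Proof.
elim: k s Q => [|k IH] s Q //=.
rewrite (unsum_coassoc dg s (fun a b c => if nilp a then 0 else
   blocksum k b (fun bl r => Q (a :: bl) r c))).
apply: eq_unsum => a p _; case: ifP => na; first by rewrite unsum0.
by rewrite -(IH p (fun bl r c => Q (a :: bl) r c)).
Qed.

End Theory.

Lemma blocksum_morph (U U' : lmodType K) (f : U -> U') k s P :
  (forall c x y, f (c *: x + y) = c *: f x + f y) ->
  f (blocksum k s P) = blocksum k s (fun bl r => f (P bl r)).
Proof.
move=> fl; have f0 : f 0 = 0.
  by have := fl (-1) 0 0; rewrite scaler0 addr0 scaleN1r addNr.
elim: k s P => [|k IH] s P //=; rewrite unsum_morph //.
by apply: eq_unsum => a b _; case: ifP.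
Qed.

Lemma chain_morph (U U' : lmodType K) (f : U -> U') ks s P :
  (forall c x y, f (c *: x + y) = c *: f x + f y) ->
  f (chain ks s P) = chain ks s (fun bl r => f (P bl r)).
Proof.
move=> fl; have f0 : f 0 = 0.
  by have := fl (-1) 0 0; rewrite scaler0 addr0 scaleN1r addNr.
elim: ks s P => [|j ks IH] s P //=; rewrite unsum_morph //.
by apply: eq_unsum => a b _; case: ifP.
Qed.

Lemma chain_eq0 (U : lmodType K) ks s (P : seq (seq X) -> seq X -> U) :
  (forall bl r, shape bl = ks -> dsum s = dsum (flatten bl) + dsum r ->
     size s = (sumn ks + size r)%N -> P bl r = 0) -> chain ks s P = 0.
Proof.
move=> P0; rewrite (eq_chain P0).
rewrite -(@chain_morph U U (fun _ => 0) ks s P) // => c x y.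
by rewrite scaler0 addr0.
Qed.

End Blocks.

Lemma blocksum_map (K : fieldType) (X Y : Type) (dX : X -> int) (dY : Y -> int)
    (h : X -> Y) (U : lmodType K) k (s : seq X)
    (P : seq (seq Y) -> seq Y -> U) :
  (forall x, dY (h x) = dX x) ->
  blocksum dY k (map h s) P
    = blocksum dX k s (fun bl r => P (map (map h) bl) (map h r)).
Proof.
move=> dh; elim: k s P => [|k IH] s P //=; rewrite (unsum_map _ _ dh).
by apply: eq_unsum => a b _; rewrite /nilp size_map IH.
Qed.

Lemma chain_map (K : fieldType) (X Y : Type) (dX : X -> int) (dY : Y -> int)
    (h : X -> Y) (U : lmodType K) ks (s : seq X)
    (P : seq (seq Y) -> seq Y -> U) :
  (forall x, dY (h x) = dX x) ->
  chain dY ks (map h s) P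
    = chain dX ks s (fun bl r => P (map (map h) bl) (map h r)).
Proof.
move=> dh; elim: ks s P => [|k ks IH] s P //=; rewrite (unsum_map _ _ dh).
by apply: eq_unsum => a b _; rewrite size_map IH.
Qed.

(** Each vector is tagged with its index, so that the shuffle condition on the
    permutation becomes a sortedness condition on the rearranged sequence, and
    [permsum_chain] applies. *)
Lemma shsumE (K : fieldType) (V : gspace K) (U : lmodType K)
    (s : seq (hvec V)) (ks : seq nat) (F : seq (hvec V) -> U) :
  sumn ks = size s ->
  shsum s ks F = chain (@hdeg K V) ks s (fun bl r => F (flatten bl ++ r)).
Proof.
move=> sks; rewrite /shsum big_mkcond /=.
pose G t y := if all (pairwise ltn) (reshape ks t) then F y else 0.
transitivity (\sum_(sg : 'S_(size s)) ksign sg *: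
     G [seq (0 + val (sg i))%N | i <- enum 'I_(size s)] (permute sg)).
  apply: eq_bigr => sg _; rewrite shuffleE // /G.
  rewrite (eq_map (fun i => add0n (val (sg i)))).
  by case: ifP; rewrite ?scaler0.
rewrite sum_permsum /G.
set q := zip _ _.
have szi : size (iota 0 (size s)) = size s by rewrite size_iota.
have sq : size q = size s by rewrite size_zip szi minnn.
have q2 : unzip2 q = s by rewrite unzip2_zip ?szi.
have q1 : unzip1 q = iota 0 (size s) by rewrite unzip1_zip ?szi.
pose r (x y : nat * hvec V) := (x.1 < y.1)%N.
transitivity (permsum (fun z : nat * hvec V => hdeg z.2) q (fun z =>
   if all (pairwise r) (reshape ks z) then F (unzip2 z) else 0)).
  apply: eq_permsum => z _ _ _; congr (if _ then _ else _).
  elim: (ks) z => [|k ks' IH] z //=; rewrite -IH /unzip1 -map_take -map_drop.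
  by rewrite pairwise_map.
rewrite (@permsum_chain _ _ _ _ r) ?sq //; last first.
- rewrite -[pairwise r q]/(pairwise (relpre fst ltn) q) -pairwise_map.
  by rewrite -/(unzip1 q) q1 -sorted_pairwise ?iota_ltn_sorted //; apply: ltn_trans.
- by move=> x y; rewrite /r -leqNgt => /ltnW.
rewrite -[in RHS]q2 (chain_map (dX := fun z : nat * hvec V => hdeg z.2)) //.
by apply: eq_chain => bl b _ _ _; rewrite /unzip2 map_cat map_flatten.
Qed.

Lemma mem_compositions k t ks :
  (ks \in compositions k t) = [&& size ks == k, all (leq 1) ks & sumn ks == t].
Proof.
rewrite mem_filter andbC; apply/andP/and3P => [[/mapP[u _ ->] /andP[]]|[/eqP sk al /eqP st]].
  by rewrite size_map size_tuple.
split; last by rewrite al st eqxx.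
have lt i : i \in ks -> (i < t.+1)%N.
  move=> iks; rewrite ltnS -st; elim: (ks) iks => //= j s IH.
  rewrite in_cons => /orP[/eqP ->|/IH/leq_trans]; first exact: leq_addr.
  by apply; apply: leq_addl.
have su : size (map (fun i => inord i : 'I_t.+1) ks) == k by rewrite size_map sk.
apply/mapP; exists (Tuple su); first by rewrite mem_enum.
rewrite /= -map_comp -[LHS]map_id; apply/eq_in_map => i /lt ilt.
by rewrite /= inordK.
Qed.

Lemma compositions_uniq k t : uniq (compositions k t).
Proof.
rewrite filter_uniq // map_inj_uniq ?enum_uniq // => u v /= /(inj_map val_inj).
exact: val_inj.
Qed.

Lemma compositions0 t : compositions 0 t = if t == 0%N then [:: [::]] else [::].
Proof.
apply/perm_small_eq; first by case: ifP.
apply: uniq_perm; [exact: compositions_uniq|by case: ifP|move=> ks].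
rewrite mem_compositions; case: ks => [|j ks] /=; last by case: ifP.
by rewrite eq_sym; case: eqP.
Qed.

Lemma big_compositionsS (U : zmodType) k t (F : seq nat -> U) :
  \sum_(ks <- compositions k.+1 t) F ks
    = \sum_(1 <= j < t.+1) \sum_(ks <- compositions k (t - j)) F (j :: ks).
Proof.
transitivity (\sum_(ks <- [seq j :: ks | j <- index_iota 1 t.+1,
                            ks <- compositions k (t - j)]) F ks).
  apply: perm_big; apply: uniq_perm; first exact: compositions_uniq.
    apply: allpairs_uniq_dep => [|j _|]; rewrite ?iota_uniq ?compositions_uniq //.
    by move=> [j ks] [j' ks'] _ _ /= [<- <-].
  move=> ks; rewrite mem_compositions; apply/and3P/allpairsPdep.
    case: ks => [[] //|j ks] [/eqP[sk] /andP[j0 al] /eqP st]; exists j, ks.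
    split=> //; first by rewrite mem_index_iota j0 ltnS -st leq_addr.
    by rewrite mem_compositions; apply/and3P; split; [apply/eqP| |rewrite -st addKn].
  case=> j [ks' [+ + ->]]; rewrite mem_index_iota mem_compositions ltnS.
  case/andP=> j0 jt /and3P[/eqP <- al /eqP st]; split=> //=; first by rewrite j0.
  by rewrite st subnKC.
by rewrite big_allpairs_dep.
Qed.

(** Any bound N > size s will do, since the blocks cannot have more than size s
    elements in total; the induction uses this freedom. *)
Lemma blocksum_compositions (K : fieldType) (X : Type) (dg : X -> int)
    (U : lmodType K) k N (s : seq X) (P : seq (seq X) -> seq X -> U) :
  (size s < N)%N ->
  \sum_(0 <= t < N) \sum_(ks <- compositions k t) chain dg ks s P
    = blocksum dg k s P.
Proof.
elim: k N s P => [|k IH] N s P sN.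
  case: N sN => // N _; rewrite big_nat_recl // compositions0 big_seq1 /=.
  by rewrite big1 ?addr0 // => t _; rewrite compositions0 big_nil.
transitivity (unsum dg s (fun a b => \sum_(0 <= t < N) \sum_(1 <= j < t.+1)
   if size a == j then \sum_(ks <- compositions k (t - j))
     chain dg ks b (fun bl r => P (a :: bl) r) else 0)).
  rewrite unsum_sum; apply: eq_bigr => t _.
  rewrite unsum_sum big_compositionsS; apply: eq_bigr => j _ /=.
  rewrite -unsum_sum; apply: eq_unsum => a b _.
  by case: ifP => // _; rewrite big1.
apply: eq_unsum => a b us; case: ifP => [/nilP ->|na].
  rewrite big1 // => t _; rewrite big_nat big1 // => j /andP[j0 _].
  by rewrite ifN // neq_ltn j0.
have a0 : (0 < size a)%N by case: (a) na.
have aN : (size a <= N)%N.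
  by rewrite (leq_trans _ (ltnW sN)) // (unshuffle_size us) leq_addr.
rewrite (big_cat_nat (n := size a)) //= big_nat big1 ?add0r; last first.
  move=> t /= ta; rewrite big_nat big1 // => j /andP[_ jt].
  by rewrite ifN // neq_ltn orbC (leq_trans jt).
have bN : (size b < N - size a)%N by rewrite ltn_subRL -(unshuffle_size us).
apply: etrans (IH _ b (fun bl r => P (a :: bl) r) bN).
rewrite -{1}[size a]add0n big_addn; apply: eq_bigr => t _.
rewrite (big_cat_nat (n := size a)) ?leqW ?leq_addl //=.
rewrite big_nat big1 ?add0r; last first.
  by move=> j /andP[_ ja]; rewrite ifN // neq_ltn ja orbT.
rewrite big_ltn ?ltnS ?leq_addl // eqxx addnK -[RHS]addr0; congr (_ + _).
by rewrite big_nat big1 // => j /andP[aj _]; rewrite ifN // neq_ltn aj.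
Qed.

(** * Brackets of a cochain with T *)

(** All that the terms with an argument 0 require of a multilinear map. *)
Definition kills_zero (K : fieldType) (V : gspace K) (U : lmodType K)
    (F : seq (hvec V) -> U) : Prop :=
  forall s1 n s2, F (s1 ++ hv (0 : V n) :: s2) = 0.

Lemma multilinear_kills_zero (K : fieldType) (V W : gspace K) (f : mmap V W) m :
  multilinear f -> kills_zero (fun s => f s m).
Proof.
move=> fl s1 n s2; have := fl s1 s2 n (-1) 0 0 m.
by rewrite scaler0 addr0 scaleN1r addNr.
Qed.

Lemma kills_zero_nth (K : fieldType) (V : gspace K) (U : lmodType K)
    (F : seq (hvec V) -> U) (x0 : hvec V) s j :
  kills_zero F -> (j < size s)%N -> tagged (nth x0 s j) = 0 -> F s = 0.
Proof.
move=> Fz js; rewrite -[in F s](cat_take_drop j s) (drop_nth x0 js).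
by case: (nth x0 s j) => n x /= ->; apply: Fz.
Qed.

(** The shuffle sum over the two sizes j and n - j, summed over j >= 1, is the
    coproduct restricted to nonempty first parts. *)
Lemma NRcircE (K : fieldType) (W : gspace K) n (f g : mmap W W) w d :
  NRcirc n f g w d
    = unsum (@hdeg K W) w (fun a b =>
        if nilp a then 0 else f (hval n g a :: b) d).
Proof.
transitivity (\sum_(1 <= j < (size w).+1) unsum (@hdeg K W) w (fun a b =>
   if size a == j then f (hval n g a :: b) d else 0)).
  rewrite /NRcirc [LHS]big_nat [RHS]big_nat.
  apply: eq_bigr => j /andP[_ jw]; rewrite shsumE /= ?addn0 ?subnKC //.
  apply: eq_unsum => a b us; case: eqP => // sa.
  have -> : (size w - j)%N = size b by rewrite (unshuffle_size us) sa addKn.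
  rewrite (unsum_full (@hdeg K W) b (fun c e =>
     f (hval n g (take j (flatten [:: a; c] ++ e))
        :: drop j (flatten [:: a; c] ++ e)) d)).
  by rewrite /= !cats0 take_size_cat ?drop_size_cat.
rewrite -unsum_sum; apply: eq_unsum => a b us.
case: ifP => [/nilP ->|na].
  by rewrite big_nat big1 // => j /andP[j0 _]; rewrite ifN // neq_ltn j0.
rewrite (big_nat_widen _ _ (size w).+1) // big_mkcond /=.
rewrite (bigD1_seq (size a)) ?iota_uniq ?mem_index_iota //=; last first.
  by rewrite ltnS (unshuffle_size us) leq_addr andbT; case: (a) na.
rewrite eqxx big1 ?addr0; last first.
  by move=> j ja; rewrite [size a == j]eq_sym (negPf ja) if_same.
by rewrite ltnS (unshuffle_size us) leq_addr.
Qed.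

Section Twisting.

Variables (K : fieldType) (g V : gspace K) (T : mmap V g).
Hypothesis Tlin : multilinear T.
Local Notation W := (gsum g V).
Local Notation dW := (@hdeg K W).
Local Notation TW := (hval 0 (hext T)).

Lemma hext_linear (e : seq (hvec W)) n d c (x y : W n) :
  hext T (hv (c *: x + y) :: e) d
    = c *: hext T (hv x :: e) d + hext T (hv y :: e) d.
Proof.
rewrite /hext /=; apply: injective_projections => /=.
  exact: (Tlin [::] _ c x.2 y.2).
by rewrite scaler0 addr0.
Qed.

Lemma hext_vanish s1 (z : hvec W) s2 d :
  (tagged z).2 = 0 -> hext T (s1 ++ z :: s2) d = 0.
Proof.
move=> z0; rewrite /hext map_cat /= /gsnd z0.
by rewrite (multilinear_kills_zero _ Tlin).
Qed.

(** The composition f o Th. *)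
Definition insT (f : mmap W W) : mmap W W := fun w d =>
  unsum dW w (fun a b => if nilp a then 0 else f (TW a :: b) d).

(** The composition Th o f, for f of degree 1. *)
Definition applyT (f : mmap W W) : mmap W W := fun w d =>
  unsum dW w (fun a b => if nilp a then 0 else hext T (hval 1 f a :: b) d).

Lemma insT_linear c f1 f2 f w d :
  (forall w d, f w d = f1 w d + c *: f2 w d) ->
  insT f w d = insT f1 w d + c *: insT f2 w d.
Proof.
move=> fE; rewrite addrC -unsum_linear; apply: eq_unsum => a b _.
by rewrite fE; case: ifP => _; rewrite ?scaler0 ?addr0 // addrC.
Qed.

Lemma applyT_linear c f1 f2 f w d :
  (forall w d, f w d = f1 w d + c *: f2 w d) ->
  applyT f w d = applyT f1 w d + c *: applyT f2 w d.
Proof.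
move=> fE; rewrite addrC -unsum_linear; apply: eq_unsum => a b _.
case: ifP => _; first by rewrite scaler0 addr0.
by rewrite /hval fE [f1 _ _ + _]addrC hext_linear.
Qed.

(** The inner application of Th produces an argument in g for the outer one. *)
Lemma applyT_applyT f w d : applyT (applyT f) w d = 0.
Proof.
apply: unsum_eq0 => a b _; case: ifP => // _.
apply: (@hext_vanish [::]); rewrite /= /applyT.
rewrite (@unsum_morph K _ _ _ _ (@snd (g (1 + degs a)) (V (1 + degs a)))) //.
by apply: unsum_eq0 => p q _; case: ifP.
Qed.

Lemma hext_unsum (s e : seq (hvec W)) n d (G : seq (hvec W) -> seq (hvec W) -> W n) :
  hext T (hv (unsum dW s G) :: e) d
    = unsum dW s (fun a b => hext T (hv (G a b) :: e) d).
Proof.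
rewrite (@unsum_morph K _ _ _ _ (fun x : W n => hext T (hv x :: e) d)) //.
by move=> c x y; rewrite hext_linear.
Qed.

(** In (Th o f) o Th the inserted Th(a) cannot be an argument of the outer Th,
    so it is an argument of f, and even the first one.  Both sides are then the
    sum of Th(f(Th(a), c), e) over the triples (a, c, e), by coassociativity. *)
Lemma insT_applyT f w d : insT (applyT f) w d = applyT (insT f) w d.
Proof.
pose G a c e : W d :=
  if nilp a then 0 else hext T (hval 1 f (TW a :: c) :: e) d.
transitivity (unsum dW w (fun a p => unsum dW p (G a))).
  apply: eq_unsum => a b _; rewrite /G; case: ifP => na; first by rewrite unsum0.
  rewrite /applyT /=; apply: eq_unsum => c e _.
  rewrite [X in _ + _ *: X](_ : _ = 0) ?scaler0 ?addr0 //; case: ifP => // _.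
  exact: (@hext_vanish [:: hval 1 f c]).
rewrite -unsum_coassoc; apply: eq_unsum => p e _.
case: ifP => [/nilP -> //|_]; rewrite /hval /insT hext_unsum.
apply: eq_unsum => a c us; rewrite /G; case: ifP => na.
  by rewrite (@hext_vanish [::]).
congr (hext T (_ :: e) d); rewrite /hval.
suff -> : degs (hv (hext T a (0 + degs a)) :: c) = degs p by [].
rewrite -[RHS]/(dsum dW p) (unshuffle_dsum dW us) /degs big_cons.
by rewrite -[hdeg (hv _)]/(0 + degs a) add0r.
Qed.

Lemma TW_vanish s1 z s2 :
  (tagged z).2 = 0 -> TW (s1 ++ z :: s2) = @hv K W (0 + degs (s1 ++ z :: s2)) 0.
Proof. by move=> z0; rewrite /hval hext_vanish. Qed.

(** One more insertion adds one more block.  The vector Th(a) inserted in front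
    cannot end up in a block, as Th would vanish there; it stays in front of
    the remainder, and moving it past the first block c costs the sign that
    [unsum_swap] needs in order to extract c before a. *)
Lemma insT_blocksum k (U : lmodType K) (F : seq (hvec W) -> U) w :
  kills_zero F ->
  unsum dW w (fun a b => if nilp a then 0 else
       blocksum dW k (TW a :: b) (fun bl r => F (map TW bl ++ r)))
    = blocksum dW k.+1 w (fun bl r => F (map TW bl ++ r)).
Proof.
elim: k F w => [|k IH] F w Fz.
  by apply: eq_unsum.
(* The first block c is absorbed into F, for the induction hypothesis. *)
pose H c := fun s => F (TW c :: s).
have Hz c : kills_zero (H c) by move=> s1 n s2; apply: (Fz (TW c :: s1)).
pose G a c e : U := if nilp a then 0 else if nilp c then 0 else
  blocksum dW k (TW a :: e) (fun bl r => H c (map TW bl ++ r)).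
transitivity (unsum dW w (fun a b => unsum dW b (fun c e =>
    koszul K dW a c *: G a c e))).
  apply: eq_unsum => a b _; rewrite /G; case: ifP => na.
    by rewrite unsum_eq0 // => *; rewrite scaler0.
  rewrite [LHS]/=; apply: eq_unsum => c e _.
  rewrite blocksum_eq0 ?add0r; last first.
    move=> bl r _ _ _; rewrite (@TW_vanish [::]) //; exact: (Fz [::]).
  congr (_ *: _); rewrite /koszul; congr (_ ^ (_ * _)).
  by rewrite /dsum big_seq1; apply: add0r.
rewrite unsum_swap [RHS]/=; apply: eq_unsum => c b _; case: ifP => nc.
  by apply: unsum_eq0 => a e _; rewrite /G nc if_same.
apply: etrans (IH (H c) b (Hz c)).
by apply: eq_unsum => a e _; rewrite /G nc.
Qed.

Lemma iter_insT k f w d :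
  kills_zero (fun s => f s d) ->
  iter k insT f w d = blocksum dW k w (fun bl r => f (map TW bl ++ r) d).
Proof.
move=> fz; elim: k w => [|k IH] w //.
rewrite -(@insT_blocksum k _ (fun s => f s d)) // iterS.
by apply: eq_unsum => a b _; rewrite IH.
Qed.

(** The binomial expansion of (insT - applyT)^k, where all terms with two
    factors applyT vanish.  For k = 0 the predecessor k.-1 is harmless because
    of the coefficient k. *)
Lemma iter_NRbracket k f (D := iter k (fun D => NRbracket D (0, hext T)) (1, f)) :
  D.1 = 1
  /\ forall w d, D.2 w d
       = iter k insT f w d - k%:R *: applyT (iter k.-1 insT f) w d.
Proof.
elim: k @D => [|k IH] /=; first by split=> // w d; rewrite scale0r subr0.
case: IH; set D := iter k _ _ => D1 D2; split=> [|w d]; first by rewrite D1 addr0.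
rewrite /NRbracket /= mulr0 expr0z scale1r !NRcircE D1.
have D2' w' d' : D.2 w' d' = iter k insT f w' d'
     + (- k%:R) *: applyT (iter k.-1 insT f) w' d'.
  by rewrite D2 scaleNr.
rewrite -/(insT D.2 w d) -/(applyT D.2 w d).
rewrite (insT_linear _ _ D2') (applyT_linear _ _ D2') applyT_applyT scaler0 addr0.
rewrite insT_applyT -addrA scaleNr -opprD -[k.+1%:R]natr1 scalerDl scale1r.
congr (_ - (_ + _)); case: k {D D1 D2 D2'} => [|k] //.
by rewrite !scale0r.
Qed.

End Twisting.

(** * Evaluation on arguments in V *)

Section Evaluation.

Variables (K : fieldType) (g V : gspace K) (l : mmap g g) (rho : rmap g V).
Hypothesis llin : multilinear l.
Hypothesis rholin : forall v, multilinear (fun x m => rho x v m : V m).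
Hypothesis rhov : forall (x : seq (hvec g)) (n : int) (a : K) (u v : V n) m,
  rho x (hv (a *: u + v)) m = a *: rho x (hv u) m + rho x (hv v) m.
Local Notation W := (gsum g V).
Local Notation dW := (@hdeg K W).
Local Notation dV := (@hdeg K V).
Local Notation Delta := (semidirect l rho).

Definition ginl (y : hvec g) : hvec W := @hv K W (hdeg y) (tagged y, 0).

Lemma rho_v0 x (v : hvec V) d : tagged v = 0 -> rho x v d = 0.
Proof.
case: v => n v /= ->; have := rhov x (-1) (0 : V n) 0 d.
by rewrite scaler0 addr0 scaleN1r addNr.
Qed.

(** Kills the terms of the semidirect sum in which a vector of V is left among
    the arguments that should come from g. *)
Lemma rho_skip0 (x0 : hvec g) (x : seq (hvec g)) i j v d :
  (i < size x)%N -> (j < size x)%N -> j != i -> tagged (nth x0 x j) = 0 ->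
  rho (take i x ++ drop i.+1 x) v d = 0.
Proof.
move=> ix jx ji xj0.
(* The position of the zero once the i-th argument is removed. *)
pose j' := if (j < i)%N then j else j.-1.
have si : size (take i x) = i by rewrite size_takel // ltnW.
apply: (@kills_zero_nth _ _ _ (fun s => rho s v d) x0 _ j').
- exact: (@multilinear_kills_zero _ _ _ (fun x m => rho x v m) d (rholin v)).
- rewrite size_cat si size_drop /j'; case: ifP => [|/negbT]; first exact: ltn_addr.
  rewrite -leqNgt leq_eqVlt eq_sym (negPf ji) /= => ij.
  by case: (j) ij jx => // j1 _ jx1; rewrite -ltnS -addSn subnKC.
rewrite nth_cat si /j'; case: (ltnP j i) => [ji'|]; first by rewrite ?ji' nth_take.
rewrite leq_eqVlt eq_sym (negPf ji) /= => ij.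
rewrite ifN -?leqNgt; last by case: (j) ij.
by rewrite nth_drop addSn -addnS; case: (j) ij xj0 => // j1; rewrite ltnS /= addnS => /subnKC ->.
Qed.

Lemma semidirect_kills_zero d : kills_zero (fun s => Delta s d).
Proof.
move=> s1 n s2; set w := s1 ++ _; pose x0 := hv (0 : W n).
have jw : (size s1 < size w)%N by rewrite size_cat addnS ltnS leq_addr.
have wj : nth x0 w (size s1) = x0 by rewrite nth_cat ltnn subnn.
apply: injective_projections => /=.
  rewrite /w map_cat /= /gfst /=.
  exact: (multilinear_kills_zero d llin).
rewrite big1 // => i _; have [ei|ni] := eqVneq (i : nat) (size s1).
  by rewrite rho_v0 ?scaler0 // (tnth_nth x0) ei /= wj.
rewrite (@rho_skip0 (gfst x0) _ _ (size s1)) ?size_map ?scaler0 1?eq_sym //.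
by rewrite (nth_map x0) // wj.
Qed.

Lemma semidirect_fst ys (r : seq (hvec V)) d :
  (Delta (map ginl ys ++ map (@ginr K g V) r) d).1
    = if nilp r then l ys d else 0.
Proof.
have e0 : map (@gfst K g V) (map ginl ys) = ys.
  by rewrite -map_comp map_id_in // => -[].
rewrite /= map_cat e0; case: r => [|v r] /=; first by rewrite cats0.
exact: (multilinear_kills_zero d llin).
Qed.

(** A term of the semidirect sum vanishes if its distinguished argument is in
    g, or if another argument comes from V; so there must be exactly one vector
    of V, the last argument, and its sign is trivial. *)
Lemma semidirect_snd ys (r : seq (hvec V)) d :
  (Delta (map ginl ys ++ map (@ginr K g V) r) d).2
    = if r is [:: v] then rho ys v d else 0.
Proof.
have e0 : map (@gfst K g V) (map ginl ys) = ys.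
  by rewrite -map_comp map_id_in // => -[].
set w := _ ++ _; have sw : size w = (size ys + size r)%N.
  by rewrite size_cat !size_map.
have w1 (i : 'I_(size w)) : (i < size ys)%N ->
    tagged (gsnd (tnth (in_tuple w) i)) = 0.
  move=> iy; rewrite (tnth_nth (tnth (in_tuple w) i)) /= nth_cat size_map iy.
  by rewrite (nth_map (hv (0 : g 0))).
have w2 j x0 : (j < size r)%N ->
    tagged (nth x0 (map (@gfst K g V) w) (size ys + j)) = 0.
  move=> jr; rewrite map_cat e0 nth_cat ltnNge leq_addr /= addKn -map_comp.
  by rewrite (nth_map (hv (0 : V 0))).
rewrite /=; case: r @w sw w1 w2 => [|v [|v' r]] w sw w1 w2.
- by rewrite big1 // => i _; rewrite rho_v0 ?scaler0 // w1 // -[X in (_ < X)%N]addn0 -sw.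
- have ys_w : (size ys < size w)%N by rewrite sw addn1.
  (* Only the term of the single vector v, which comes last, is nonzero. *)
  rewrite (bigD1 (Ordinal ys_w)) //= big1 ?addr0 => [|i ni].
    rewrite (tnth_nth (ginr g v)) /= nth_cat size_map ltnn subnn /=.
    rewrite map_cat e0 take_size_cat // drop_oversize ?size_cat ?addn1 //.
    rewrite cats0 /degs big_nil mulr0 expr0z scale1r.
    by case: v {w sw w1 w2 ys_w}.
  rewrite rho_v0 ?scaler0 // w1 //.
  have := ltn_ord i; rewrite {2}sw addn1 ltnS leq_eqVlt => /orP[/eqP ei|//].
  by case/eqP: ni; apply: val_inj.
- pose x0 := gfst (ginr g v).
  (* Whichever argument is distinguished, v or v' is left among the others. *)
  rewrite big1 // => i _.
  have [ei|ni] := eqVneq (i : nat) (size ys).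
    rewrite (@rho_skip0 x0 _ _ (size ys + 1)) ?size_map ?scaler0 //.
    + by rewrite sw /= ltn_add2l.
    + by rewrite ei -{2}[size ys]addn0 eqn_add2l.
    + by rewrite w2.
  rewrite (@rho_skip0 x0 _ _ (size ys + 0)) ?size_map ?scaler0 //.
  + by rewrite sw /= ltn_add2l.
  + by rewrite addn0 eq_sym.
  + by rewrite w2.
Qed.

Variable T : mmap V g.
Hypothesis Tlin : multilinear T.
Local Notation hT := (hval 0 T).

Lemma map_gsnd_ginr (s : seq (hvec V)) : map (@gsnd K g V) (map (@ginr K g V) s) = s.
Proof. by rewrite -map_comp map_id_in // => -[]. Qed.

Lemma degs_ginr (s : seq (hvec V)) : degs (map (@ginr K g V) s) = degs s.
Proof. by rewrite /degs big_map. Qed.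

Lemma hval_hext_ginr a : hval 0 (hext T) (map (@ginr K g V) a) = ginl (hT a).
Proof. by rewrite /hval /hext degs_ginr map_gsnd_ginr. Qed.

Lemma iter_insT_ginr k v d :
  iter k (insT T) Delta (map (@ginr K g V) v) d
    = blocksum dV k v (fun bl r =>
        Delta (map ginl (map hT bl) ++ map (@ginr K g V) r) d).
Proof.
rewrite iter_insT //; last exact: semidirect_kills_zero.
rewrite (@blocksum_map _ _ _ dV) //; apply: eq_blocksum => bl r _ _ _.
congr (Delta (_ ++ _) d); rewrite -!map_comp; apply: eq_map => a /=.
exact: hval_hext_ginr.
Qed.

(** Up to the factor 1/n!, the n-th term of the right-hand side of the
    Rota-Baxter identity. *)
Definition lT (n : nat) (v : seq (hvec V)) (d : int) : g d :=
  blocksum dV n v (fun bl r => if nilp r then l (map hT bl) d else 0).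

(** Up to the factor 1/m!, the terms of the left-hand side of the Rota-Baxter
    identity with m inner copies of T. *)
Definition TrhoT (m : nat) (v : seq (hvec V)) (d : int) : g d :=
  blocksum dV m v (fun bl r => unsum dV r (fun c b =>
    if c is [:: w] then T (rval rho (map hT bl) w :: b) d else 0)).

Lemma iter_insT_fst k v d :
  (iter k (insT T) Delta (map (@ginr K g V) v) d).1 = lT k v d.
Proof.
rewrite iter_insT_ginr (@blocksum_morph _ _ _ _ _ (@fst (g d) (V d))) //.
by apply: eq_blocksum => bl r _ _ _; rewrite semidirect_fst.
Qed.

(** The outer T receives a vector c of V built from a part of v, together with
    the complement b of this part; linearity of T in c and coassociativity
    bring the sum into the form [TrhoT]. *)
Lemma applyT_iter_insT_fst m v d :
  (applyT T (iter m (insT T) Delta) (map (@ginr K g V) v) d).1 = TrhoT m v d.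
Proof.
rewrite /applyT (@unsum_morph _ _ _ _ _ (@fst (g d) (V d))) //.
rewrite (@unsum_map _ _ _ dV) // /TrhoT.
rewrite -(unsum_blocksum dV m v (fun bl c b =>
   if c is [:: w] then T (rval rho (map hT bl) w :: b) d else 0)).
apply: eq_unsum => a b _; rewrite /nilp size_map.
case: eqP => [/size0nil ->|_].
  rewrite blocksum_eq0 // => bl [|w r] _ //.
  by rewrite /= addnS.
rewrite /hext /= map_gsnd_ginr /gsnd /=.
set n := 1 + _; rewrite iter_insT_ginr.
rewrite (@blocksum_morph _ _ _ _ _ (@snd (g n) (V n))) //.
rewrite (@blocksum_morph _ _ _ _ _ (fun x : V n => T (hv x :: b) d)); last first.
  by move=> c x y; rewrite (Tlin [::]).
apply: eq_blocksum => bl r _ _ ds; rewrite semidirect_snd.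
have T0 : T (hv (0 : V n) :: b) d = 0 by apply: (multilinear_kills_zero d Tlin [::]).
case: r ds => [|w [|w' r]] // ds.
congr (T (_ :: b) d); rewrite /rval /n degs_ginr.
suff -> : degs a = degs (map hT bl) + hdeg w by reflexivity.
rewrite -[LHS]/(dsum dV a) ds dsum_cons {2}/dsum big_nil addr0; congr (_ + _).
rewrite /dsum /degs big_flatten big_map /=; apply: eq_bigr => c _.
by rewrite -[RHS]/(0 + degs c) add0r.
Qed.

Lemma hbracket_nseq k v d :
  hbracket l rho (nseq k.+1 (0, T)) v d
    = lT k.+1 v d - k.+1%:R *: TrhoT k v d.
Proof.
rewrite /hbracket map_nseq.
have -> (D : int * mmap W W) n : foldl (@NRbracket K W) D (nseq n (0, hext T))
   = iter n (fun D => NRbracket D (0, hext T)) D.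
  by elim: n D => // n IH D; rewrite iterSr /= IH.
have [_ DE] := iter_NRbracket Tlin k.+1 Delta.
by rewrite /hproj DE -iter_insT_fst -applyT_iter_insT_fst.
Qed.

Lemma lT_eq0 n v d : (size v < n)%N -> lT n v d = 0.
Proof.
move=> vn; apply: blocksum_eq0 => bl r _ sz _.
by move: (leq_trans (leq_addr _ _) sz); rewrite leqNgt vn.
Qed.

Lemma TrhoT_eq0 m v d : (size v <= m)%N -> TrhoT m v d = 0.
Proof.
move=> vm; apply: blocksum_eq0 => bl r _ sz _.
have : (m + size r <= m + 0)%N by rewrite addn0 (leq_trans sz).
by rewrite leq_add2l leqn0 => /nilP ->.
Qed.

(** The coefficient k/k! = 1/(k-1)! accounts for the shift of the second sum;
    in both sums the terms beyond size v vanish for lack of vectors. *)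
Lemma Maurer_Cartan_sum (char0 : [pchar K] =i pred0) n v d :
  (size v <= n)%N ->
  \sum_(1 <= k < n.+1) (k`!)%:R^-1 *: hbracket l rho (nseq k (0, T)) v d
    = \sum_(1 <= k < (size v).+1) (k`!)%:R^-1 *: lT k v d
      - \sum_(0 <= m < size v) (m`!)%:R^-1 *: TrhoT m v d.
Proof.
move=> vn; have nz k : (k.+1%:R : K) != 0 by rewrite (pcharf0P K).1.
transitivity (\sum_(1 <= k < n.+1) (k`!)%:R^-1 *: lT k v d
      - \sum_(0 <= m < n) (m`!)%:R^-1 *: TrhoT m v d).
  rewrite !big_add1 /= -sumrB; apply: eq_bigr => k _.
  rewrite hbracket_nseq scalerBr scalerA factS natrM invfM mulrAC mulVf //.
  by rewrite mul1r.
congr (_ - _).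
  rewrite (big_cat_nat (n := (size v).+1)) //= -[RHS]addr0; congr (_ + _).
  by rewrite big_nat big1 // => k /andP[vk _]; rewrite lT_eq0 ?scaler0.
rewrite (big_cat_nat (n := size v)) //= -[RHS]addr0; congr (_ + _).
by rewrite big_nat big1 // => k /andP[vk _]; rewrite TrhoT_eq0 ?scaler0.
Qed.

Lemma reshape_flatten_cat (X : Type) (bl : seq (seq X)) r :
  reshape (shape bl) (flatten bl ++ r) = bl.
Proof.
elim: bl => //= a bl IH.
by rewrite -catA take_size_cat // drop_size_cat // IH.
Qed.

(** For blocks of total size at most size v, the condition that the remainder
    be empty selects the compositions of size v. *)
Lemma shsum_lT n v d :
  \sum_(ks <- compositions n (size v))
     shsum v ks (fun y => (n`!)%:R^-1 *: l (map hT (reshape ks y)) d)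
  = (n`!)%:R^-1 *: lT n v d.
Proof.
set c := _^-1.
have cl (c1 : K) (x y : g d) : c *: (c1 *: x + y) = c1 *: (c *: x) + c *: y.
  by rewrite scalerDr !scalerA mulrC.
rewrite /lT -(@blocksum_compositions _ _ _ _ _ (size v).+1) // big_nat_recr //=.
rewrite [X in X + _](_ : _ = 0) ?add0r; last first.
  rewrite big_nat big1 // => t /andP[_ tv]; rewrite big_seq big1 // => ks.
  rewrite mem_compositions => /and3P[_ _ /eqP st].
  apply: chain_eq0 => bl r _ _ sv; case: nilP => // r0.
  by move: tv; rewrite sv r0 addn0 st ltnn.
rewrite scaler_sumr big_seq [RHS]big_seq; apply: eq_bigr => ks.
rewrite mem_compositions => /and3P[_ _ /eqP st]; rewrite shsumE //.
rewrite (chain_morph _ _ _ _ cl); apply: eq_chain => bl r sbl _ sv.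
rewrite -sbl reshape_flatten_cat (_ : nilp r) //.
by rewrite /nilp -(eqn_add2l (sumn ks)) addn0 -sv st.
Qed.

(** The last two blocks of the shuffle, of sizes 1 and size v - 1 - t, are a
    splitting of the remainder left by the first m blocks.  In the sum over t
    from 0 to size v implicit in [TrhoT], the term t = size v is zero: it
    leaves no vector for the block of size 1. *)
Lemma shsum_TrhoT v d :
  \sum_(0 <= t < size v) \sum_(0 <= m < t.+1) \sum_(ks <- compositions m t)
     shsum v (ks ++ [:: 1; size v - 1 - t]%N)
       (fun y => (m`!)%:R^-1 *:
          (if drop t y is w :: r then
             T (rval rho (map hT (reshape ks y)) w :: r) d
           else 0))
  = \sum_(0 <= m < size v) (m`!)%:R^-1 *: TrhoT m v d.
Proof.
pose P (bl : seq (seq (hvec V))) r := unsum dV r (fun c b =>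
    if c is [:: w] then T (rval rho (map hT bl) w :: b) d else 0).
transitivity (\sum_(0 <= t < size v) \sum_(0 <= m < size v)
   (m`!)%:R^-1 *: \sum_(ks <- compositions m t) chain dV ks v P); last first.
  rewrite exchange_big_nat /=; apply: eq_bigr => m _; rewrite -scaler_sumr.
  congr (_ *: _); rewrite /TrhoT -(@blocksum_compositions _ _ _ _ _ (size v).+1) //.
  rewrite big_nat_recr //= -[LHS]addr0; congr (_ + _).
  rewrite big_seq big1 // => ks.
  rewrite mem_compositions => /and3P[_ _ /eqP st].
  apply: chain_eq0 => bl r _ _ sv.
  suff /nilP -> : nilp r by [].
  by rewrite /nilp -(eqn_add2l (sumn ks)) addn0 -sv st.
rewrite [LHS]big_nat [RHS]big_nat; apply: eq_bigr => t /andP[_ tv].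
rewrite [RHS](big_cat_nat (n := t.+1)) //=.
rewrite [X in _ = _ + X](_ : _ = 0) ?addr0; last first.
  rewrite big_nat big1 // => m /andP[tm _]; rewrite big_seq big1 ?scaler0 // => ks; rewrite mem_compositions.
  case/and3P=> /eqP sk al /eqP st; move: tm; rewrite -sk -st ltnNge.
  suff -> : (size ks <= sumn ks)%N by [].
  by elim: (ks) al => //= j s IH /andP[j0 /IH]; rewrite -add1n; apply: leq_add.
apply: eq_bigr => m _; set c := _^-1.
have cl (c1 : K) (x y : g d) : c *: (c1 *: x + y) = c1 *: (c *: x) + c *: y.
  by rewrite scalerDr !scalerA mulrC.
rewrite scaler_sumr big_seq [RHS]big_seq; apply: eq_bigr => ks.
rewrite mem_compositions => /and3P[_ _ /eqP st].
rewrite shsumE; last by rewrite sumn_cat st /= addn0 addnA addn1 -subnDA add1n subnKC.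
rewrite chain_cat (chain_morph _ _ _ _ cl); apply: eq_chain => bl r sbl _ sv.
rewrite /P (unsum_morph _ _ _ cl) /=; apply: eq_unsum => a b us.
case: a us => [|w [|w' a]] us; rewrite ?scaler0 //=.
have -> : (size v - 1 - t)%N = size b.
  by rewrite sv st (unshuffle_size us) /= add1n addnS subn1 /= addKn.
rewrite (unsum_full dV b (fun a0 b0 => c *: match drop t (flatten (bl ++ [:: [:: w]; a0]) ++ b0)
  with [::] => 0 | w0 :: r0 => T (rval rho (map hT (reshape ks
     (flatten (bl ++ [:: [:: w]; a0]) ++ b0))) w0 :: r0) d end)).
rewrite flatten_cat -catA -sbl reshape_flatten_cat.
rewrite drop_size_cat /= ?cats0 //.
by rewrite size_flatten sbl st.
Qed.

End Evaluation.

(** * The equivalence *)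

Theorem theorem5p10 (K : fieldType) (char0 : [pchar K] =i pred0)
    (g V : gspace K) (l : mmap g g) (rho : rmap g V)
    (hg : LInfty_algebra l) (hV : LInfty_representation l rho)
    (T : mmap V g) (hT : inHom 0 T) :
  homotopy_relative_RB l rho T <-> Maurer_Cartan l rho T.
Proof.
have [llin _ _ _] := hg.1; have [rholin rhov _ _ _] := hV; have [Tlin _ _ _] := hT.
have MC := Maurer_Cartan_sum llin rholin rhov Tlin char0.
have RB v d := shsum_TrhoT rho T v d.
have lTE v d : \sum_(1 <= n < (size v).+1) \sum_(ks <- compositions n (size v))
        shsum v ks
          (fun y => (n`!)%:R^-1 *: l (map (hval 0 T) (reshape ks y)) d)
   = \sum_(1 <= n < (size v).+1) (n`!)%:R^-1 *: lT l T n v d.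
  by apply: eq_bigr => n _; rewrite shsum_lT.
split=> [[_ H]|[_ H]]; split=> //.
  move=> p; exists p => n pn v d vp; rewrite MC ?(leq_trans vp) //.
  have [v0|v0] := posnP (size v); first by rewrite v0 !big_geq // subrr.
  by rewrite -lTE -RB (H (size v)) // subrr.
move=> p v d p0 <-; rewrite RB lTE; have [N HN] := H (size v).
have := HN (maxn N (size v)) (leq_maxl _ _) v d (leqnn _).
by rewrite MC ?leq_maxr // => /eqP; rewrite subr_eq0 => /eqP ->.
Qed.
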